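(* If $G$ is a diagonal graph then the coefficients of the magnitude $\#G$ alternate in sign (that is, for each $l\ge0$ the coefficient of $q^l$ is $(-1)^l$ times a non-negative integer), and $\#G$ determines $\mathrm{MH}_{*,*}(G)$ up to isomorphism (that is, if $G$ and $G'$ are diagonal graphs with $\#G=\#G'$ then $\mathrm{MH}_{*,*}(G)\cong\mathrm{MH}_{*,*}(G')$ as bigraded abelian groups).
   Context: A graph is a finite undirected graph with no loops or multiple edges. $d(x,y)=d_G(x,y)$ is the length of a shortest edge path from $x$ to $y$ ($\infty$ if in different components). Magnitude: for a graph $G$ and $t>0$, equip $V(G)$ with the metric $t\cdot d_G$; the magnitude of a finite metric space is the sum of all entries of the inverse of the matrix $(e^{-d(x,y)})_{x,y}$ (when invertible). Writing $q=e^{-t}$, this is a rational function in $q$ whose power series expansion at $q=0$ has integer coefficients, and $\#G\in\mathbb{Z}[[q]]$ denotes this power series. Equivalently, $\#G$ is the sum of all entries of the inverse over $\mathbb{Z}[[q]]$ of the matrix $(q^{d_G(x,y)})_{x,y\in V(G)}$, with $q^\infty=0$. Magnitude homology: the length of a tuple of vertices is $\ell(x_0,\dots,x_k)=\sum_{i=1}^{k} d(x_{i-1},x_i)$. $\mathrm{MC}_{k,l}(G)$ ($k,l\ge0$) is the free abelian group on tuples $(x_0,\dots,x_k)$ of vertices with consecutive entries distinct and $\ell(x_0,\dots,x_k)=l$. The differential $\partial\colon \mathrm{MC}_{k,l}(G)\to\mathrm{MC}_{k-1,l}(G)$ is $\partial=\sum_{i=1}^{k-1}(-1)^i\partial_i$,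 where $\partial_i$ omits the $i$-th entry $x_i$ if the resulting tuple still has length $l$, and is $0$ otherwise. $\mathrm{MH}_{k,l}(G)=H_k(\mathrm{MC}_{*,l}(G))$. A graph $G$ is diagonal if $\mathrm{MH}_{k,l}(G)=0$ for $k\neq l$. *)

(* Defs.v *)
From HB Require Import structures.
From mathcomp Require Import all_boot all_order all_algebra.
From mathcomp Require Import boolp.

Set Implicit Arguments.
Unset Strict Implicit.
Unset Printing Implicit Defensive.

Import GRing.Theory Quotient.

Local Open Scope ring_scope.

(* Formal power series in q with integer coefficients. *)
Record zseries := ZSeries { coefz : nat -> int }.

HB.instance Definition _ := gen_eqMixin zseries.
HB.instance Definition _ := gen_choiceMixin zseries.

Definition zseries_zero := ZSeries (fun=> 0).
Definition zseries_one := ZSeries (fun n => (n == 0)%:R).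
Definition zseries_opp a := ZSeries (fun n => - coefz a n).
Definition zseries_add a b := ZSeries (fun n => coefz a n + coefz b n).
Definition zseries_mul a b :=
  ZSeries (fun n => \sum_(i < n.+1) coefz a i * coefz b (n - i)).

Lemma zseriesP a b : coefz a =1 coefz b -> a = b.
Proof. by case: a b => [a] [b] /= /funext ->. Qed.

Lemma zseries_addA : associative zseries_add.
Proof. by move=> a b c; apply: zseriesP => n /=; rewrite addrA. Qed.
Lemma zseries_addC : commutative zseries_add.
Proof. by move=> a b; apply: zseriesP => n /=; rewrite addrC. Qed.
Lemma zseries_add0 : left_id zseries_zero zseries_add.
Proof. by move=> a; apply: zseriesP => n /=; rewrite add0r. Qed.
Lemma zseries_addN : left_inverse zseries_zero zseries_opp zseries_add.
Proof. by move=> a; apply: zseriesP => n /=; rewrite addNr. Qed.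

HB.instance Definition _ := GRing.isZmodule.Build zseries
  zseries_addA zseries_addC zseries_add0 zseries_addN.

Definition zseries_trunc m a : {poly int} := \poly_(i < m) coefz a i.

Lemma coefz_mul_trunc m a b n : (n < m)%N ->
  coefz (zseries_mul a b) n = (zseries_trunc m a * zseries_trunc m b)`_n.
Proof.
move=> lt_nm; rewrite coefM /=; apply: eq_bigr => i _.
have le_in : (i <= n)%N by rewrite -ltnS.
by rewrite !coef_poly (leq_ltn_trans le_in lt_nm) (leq_ltn_trans (leq_subr _ _)).
Qed.

Lemma zseries_mulC : commutative zseries_mul.
Proof.
by move=> a b; apply: zseriesP => n; rewrite !(@coefz_mul_trunc n.+1) // mulrC.
Qed.

Lemma zseries_mulA : associative zseries_mul.
Proof.
move=> a b c; apply: zseriesP => n; rewrite !(@coefz_mul_trunc n.+1) //.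
set A := zseries_trunc _ a; set B := zseries_trunc n.+1 b.
set C := zseries_trunc n.+1 c.
transitivity ((A * (B * C))`_n).
  rewrite !coefM; apply: eq_bigr => i _; congr (_ * _).
  by rewrite coef_poly ltnS leq_subr (@coefz_mul_trunc n.+1) ?ltnS ?leq_subr.
rewrite mulrA !coefM; apply: eq_bigr => i _; congr (_ * _).
by rewrite coef_poly ltn_ord (@coefz_mul_trunc n.+1) ?ltn_ord.
Qed.

Lemma zseries_mul1 : left_id zseries_one zseries_mul.
Proof.
move=> a; apply: zseriesP => n /=.
by rewrite big_ord_recl mul1r subn0 big1 ?addr0 // => i _; rewrite mul0r.
Qed.

Lemma zseries_mulDl : left_distributive zseries_mul zseries_add.
Proof.
move=> a b c; apply: zseriesP => n /=.
by rewrite -big_split; apply: eq_bigr => i _; rewrite mulrDl.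
Qed.

Lemma zseries_one_neq0 : zseries_one != zseries_zero.
Proof. by apply/eqP => -[] /(congr1 (@^~ 0)). Qed.

HB.instance Definition _ := GRing.Zmodule_isComNzRing.Build zseries
  zseries_mulA zseries_mulC zseries_mul1 zseries_mulDl zseries_one_neq0.

Definition zseries_unit : pred zseries := fun a => `[< exists b, b * a = 1 >].

Definition zseries_inv (a : zseries) : zseries :=
  if pselect (exists b, b * a = 1) is left h then projT1 (cid h) else a.

Lemma zseries_mulVr : {in zseries_unit, left_inverse 1 zseries_inv *%R}.
Proof.
move=> a /asboolP h; rewrite /zseries_inv; case: pselect => // h'.
by case: (cid h').
Qed.

Lemma zseries_unitP a b : b * a = 1 -> zseries_unit a.
Proof. by move=> ba1; apply/asboolP; exists b. Qed.

Lemma zseries_inv_out : {in [predC zseries_unit], zseries_inv =1 id}.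
Proof.
move=> a; rewrite inE => /asboolPn h; rewrite /zseries_inv.
by case: pselect.
Qed.

HB.instance Definition _ := GRing.ComNzRing_hasMulInverse.Build zseries
  zseries_mulVr zseries_unitP zseries_inv_out.

Definition qpow (n : nat) : zseries := ZSeries (fun m => (m == n)%:R).

Record graph := Graph {
  vertex :> finType;
  adj : rel vertex;
  adj_sym : symmetric adj;
  adj_irr : irreflexive adj }.

Definition walk (G : graph) (k : nat) (x y : G) : bool :=
  [exists p : k.-tuple G, path (@adj G) x p && (last x p == y)].

(* Distances and lengths live in [option nat], with [None] for infinity.
   If y can be reached from x, then a shortest path has fewer than #|G| edges;
   see [gdist_SomeP] and [gdist_NoneP]. *)
Definition gdist (G : graph) (x y : G) : option nat :=
  ohead [seq k <- iota 0 #|G| | walk k x y].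

Lemma walk_short (G : graph) (k : nat) (x y : G) :
  walk k x y -> exists2 j, walk j x y & (j < #|G|)%N && (j <= k)%N.
Proof.
case/existsP => p /andP[e_p /eqP <-].
case/shortenP: e_p => p' e_p' Up' sub_p'.
exists (size p'); first by apply/existsP; exists (in_tuple p'); rewrite e_p' /=.
apply/andP; split; first by rewrite -[_.+1]/(size (x :: p')) -(card_uniqP Up') max_card.
by rewrite -(size_tuple p) uniq_leq_size //; case/andP: Up'.
Qed.

Lemma gdist_SomeP (G : graph) (x y : G) (k : nat) :
  gdist x y = Some k <-> walk k x y /\ (forall j, walk j x y -> (k <= j)%N).
Proof.
rewrite /gdist; set s := [seq _ <- _ | _].
have s_mem j : (j \in s) = walk j x y && (j < #|G|)%N.
  by rewrite mem_filter mem_iota.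
have s_sorted : sorted ltn s by rewrite sorted_filter ?iota_ltn_sorted //; exact: ltn_trans.
have s_min i : ohead s = Some i -> walk i x y /\ (forall j, walk j x y -> (i <= j)%N).
  case: (s) s_mem s_sorted => // a s' s_mem /= s'_path [<-]; split.
    by have := s_mem a; rewrite mem_head => /esym/andP[].
  move=> j /walk_short[j' wj' /andP[lt_j' le_j'j]].
  apply: leq_trans le_j'j; have := s_mem j'; rewrite wj' lt_j' inE.
  case/orP => [/eqP -> // | j's'].
  by apply: ltnW; exact: (allP (order_path_min ltn_trans s'_path)).
split=> [/s_min // | [wk min_k]].
case E: (ohead s) => [i|].
  have [wi min_i] := s_min _ E.
  by congr Some; apply/eqP; rewrite eqn_leq min_k // min_i.
have [j wj /andP[lt_j _]] := walk_short wk.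
by have := s_mem j; rewrite wj lt_j; case: (s) E.
Qed.

Lemma gdist_NoneP (G : graph) (x y : G) :
  gdist x y = None <-> (forall k, ~~ walk k x y).
Proof.
split=> [E k | no_walk].
  apply/negP => /walk_short[j wj /andP[lt_j _]]; move: E; rewrite /gdist.
  have : j \in [seq k <- iota 0 #|G| | walk k x y] by rewrite mem_filter wj mem_iota.
  by case: [seq _ <- _ | _].
by case E: (gdist x y) => [k|//]; have [] := proj1 (gdist_SomeP _ _ _) E;
  rewrite (negPf (no_walk k)).
Qed.

(* q ^ d, with q ^ infinity = 0. *)
Definition qpow_dist (d : option nat) : zseries := oapp qpow 0 d.

Definition zeta (G : graph) : 'M[zseries]_#|G| :=
  \matrix_(i, j) qpow_dist (gdist (enum_val i) (enum_val j)).

Definition magnitude (G : graph) : zseries :=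
  \sum_i \sum_j invmx (zeta G) i j.

Definition const_coefz (a : zseries) : int := coefz a 0.

Lemma const_coefz_is_zmod_morphism : zmod_morphism const_coefz.
Proof. by []. Qed.
Lemma const_coefz_is_monoid_morphism : monoid_morphism const_coefz.
Proof. by split=> // a b; rewrite /const_coefz /= big_ord1. Qed.
HB.instance Definition _ := GRing.isZmodMorphism.Build zseries int const_coefz
  const_coefz_is_zmod_morphism.
HB.instance Definition _ := GRing.isMonoidMorphism.Build zseries int const_coefz
  const_coefz_is_monoid_morphism.

Lemma zseries_unit1 (a : zseries) : coefz a 0 = 1 -> a \is a GRing.unit.
Proof.
move=> a0; have [u def_u] : exists u : zseries, u = 1 - a by exists (1 - a).
have u0 : coefz u 0 = 0 by rewrite def_u /= a0 subrr.
have uk0 k n : (n < k)%N -> coefz (u ^+ k) n = 0.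
  elim: k n => // k IHk n lt_nk; rewrite exprS /= big1 // => i _.
  have [-> | i_gt0] := posnP i; first by rewrite u0 mul0r.
  rewrite IHk ?mulr0 //.
  apply: leq_trans (_ : (n <= k)%N); last by rewrite -ltnS.
  by rewrite ltn_subrL i_gt0 (leq_trans i_gt0) // -ltnS.
pose b := ZSeries (fun n => \sum_(k < n.+1) coefz (u ^+ k) n).
apply/asboolP; exists b; apply: zseriesP => n.
have coefz_sum m (f : nat -> zseries) j :
    coefz (\sum_(k < m) f k) j = \sum_(k < m) coefz (f k) j.
  by elim: m => [|m IHm]; rewrite ?big_ord0 // !big_ord_recr /= IHm.
pose B := \sum_(k < n.+1) u ^+ k.
have bB j : (j <= n)%N -> coefz b j = coefz B j.
  move=> le_jn; rewrite coefz_sum /= -!(big_mkord xpredT (fun k => coefz (u ^+ k) j)).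
  rewrite [RHS](big_cat_nat _ (n := j.+1)) //= [X in _ + X]big_nat_cond.
  by rewrite [X in _ + X]big1 ?addr0 // => k /andP[/andP[lt_jk _] _]; rewrite uk0.
have -> : coefz (b * a) n = coefz (B * a) n.
  by apply: eq_bigr => i _; congr (_ * _); apply: bB; rewrite -ltnS.
have -> : B * a = 1 - u ^+ n.+1.
  have -> : a = 1 - u by rewrite def_u subKr.
  by rewrite mulrC -(opprB u) mulNr -subrX1 opprB.
by rewrite /= uk0 // subr0.
Qed.

(* So [invmx (zeta G)] is the inverse over Z[[q]], never the default value. *)
Lemma zeta_unit (G : graph) : zeta G \in unitmx.
Proof.
rewrite unitmxE; apply: zseries_unit1.
rewrite -[LHS]/(const_coefz _) -det_map_mx -[RHS](det1 _ #|G|); congr (\det _).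
apply/matrixP => i j; rewrite !mxE /const_coefz.
have [<- | ne_ij] := eqVneq i j.
  have -> // : gdist (enum_val i) (enum_val i) = Some 0.
  by apply/gdist_SomeP; split=> //; apply/existsP; exists [tuple] => /=.
case E: (gdist _ _) => [[|k]|] //=.
have [/existsP[p]] := proj1 (gdist_SomeP _ _ _) E.
by rewrite tuple0 /= => /eqP/enum_val_inj/eqP; rewrite (negPf ne_ij).
Qed.

Definition oaddn (a b : option nat) : option nat :=
  if (a, b) is (Some m, Some n) then Some (m + n)%N else None.

Definition tlength (G : graph) (s : seq G) : option nat :=
  if s is x :: s' then foldr oaddn (Some 0) (pairmap (@gdist G) x s') else Some 0.

Definition mc_tuple (G : graph) (k l : nat) (t : k.+1.-tuple G) : bool :=
  sorted (fun x y => x != y) t && (tlength t == Some l).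

Definition mc_gen (G : graph) (k l : nat) := {t : k.+1.-tuple G | mc_tuple l t}.

(* The free abelian group on the finite set [mc_gen G k l]. *)
Definition MC (G : graph) (k l : nat) := {ffun mc_gen G k l -> int}.

Definition mc_basis (G : graph) (k l : nat) (s : mc_gen G k l) : MC G k l :=
  [ffun u => (u == s)%:R].

Definition omit (G : graph) (k : nat) (i : 'I_k.+2) (t : k.+2.-tuple G) :
  k.+1.-tuple G := [tuple tnth t (lift i j) | j < k.+1].

(* [insub] tests [mc_tuple l (omit i t)].  When t is a generator this is the
   condition that [omit i t] still has length l: consecutive entries of
   [omit i t] can only coincide if the length has dropped. *)
Definition mc_face (G : graph) (k l : nat) (i : 'I_k.+2) (t : k.+2.-tuple G) :
  MC G k l := if insub (omit i t) is Some s then mc_basis s else 0.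

Definition mc_diff (G : graph) (k l : nat) (c : MC G k.+1 l) : MC G k l :=
  \sum_(t : mc_gen G k.+1 l)
    (\sum_(i : 'I_k.+2 | (0 < i < k.+1)%N) mc_face l i (val t) *~ (-1) ^+ i)
      *~ c t.

Lemma mc_diff_is_zmod_morphism (G : graph) (k l : nat) :
  zmod_morphism (@mc_diff G k l).
Proof.
move=> c d; rewrite /mc_diff -sumrB; apply: eq_bigr => t _.
by rewrite !ffunE mulrzBr.
Qed.
HB.instance Definition _ (G : graph) (k l : nat) :=
  GRing.isZmodMorphism.Build (MC G k.+1 l) (MC G k l) (@mc_diff G k l)
    (@mc_diff_is_zmod_morphism G k l).

Definition mc_cycle (G : graph) (k l : nat) : {pred MC G k l} :=
  match k return {pred MC G k l} with
  | 0 => predT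
  | k'.+1 => fun c => mc_diff c == 0
  end.

Lemma mc_cycle_zmod_closed (G : graph) (k l : nat) : zmod_closed (@mc_cycle G k l).
Proof.
case: k => [|k] //; split=> [|c d]; rewrite !unfold_in; first by rewrite raddf0.
by move=> /eqP dc /eqP dd; rewrite raddfB /= dc dd subrr.
Qed.
HB.instance Definition _ (G : graph) (k l : nat) :=
  GRing.isZmodClosed.Build (MC G k l) (@mc_cycle G k l)
    (@mc_cycle_zmod_closed G k l).

Definition MZ (G : graph) (k l : nat) := {c : MC G k l | c \in @mc_cycle G k l}.
HB.instance Definition _ (G : graph) (k l : nat) :=
  SubChoice.on (MZ G k l).
HB.instance Definition _ (G : graph) (k l : nat) :=
  [SubChoice_isSubZmodule of MZ G k l by <:].

(* As mc_diff o mc_diff = 0, every mc_diff c is the value of such a z. *)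
Definition mc_boundary (G : graph) (k l : nat) : {pred MZ G k l} :=
  fun z => `[< exists c : MC G k.+1 l, mc_diff c = val z >].

Lemma mc_boundary_zmod_closed (G : graph) (k l : nat) :
  zmod_closed (@mc_boundary G k l).
Proof.
split=> [|z w]; first by apply/asboolP; exists 0; rewrite !raddf0.
move=> /asboolP[c dc] /asboolP[d dd]; apply/asboolP; exists (c - d).
by rewrite !raddfB /= dc dd.
Qed.
HB.instance Definition _ (G : graph) (k l : nat) :=
  GRing.isZmodClosed.Build (MZ G k l) (@mc_boundary G k l)
    (@mc_boundary_zmod_closed G k l).

Definition MH (G : graph) (k l : nat) : zmodType := {quot @mc_boundary G k l}.

Definition diagonal (G : graph) : Prop :=
  forall k l : nat, k <> l -> forall h : MH G k l, h = 0.

Definition bigraded_iso (A B : nat -> nat -> zmodType) : Prop :=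
  forall k l : nat, exists f : {additive A k l -> B k l}, bijective f.

(* Main.v *)
From HB Require Import structures.
Require Import Defs.
From mathcomp Require Import all_boot all_order all_algebra zify.
From mathcomp Require Import boolp.

Set Implicit Arguments.
Unset Strict Implicit.
Unset Printing Implicit Defensive.

Import GRing.Theory.
Local Open Scope ring_scope.

(** Fix a length l.  Two facts about the complex MC_{*,l}(G) are combined.

    First, the coefficient of q^l in the magnitude is the Euler characteristic
    of MC_{*,l}(G) ([magnitude_coef]).  Writing zeta = 1 + N, where N is the
    off-diagonal part, the inverse of zeta is the geometric series of the
    (-N)^k, and the entries of N^k enumerate by length the sequences of k+1
    vertices whose consecutive entries are distinct, that is, the generators
    of MC_{k,*}(G).

    Secondly, MC_{k,l}(G) = 0 for k > l, since consecutive distinct vertices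
    are at distance at least 1.  If G is diagonal, the complex is therefore
    exact except in degree k = l, where the homology is the group of cycles.
    This group is the kernel of an integer matrix, so it is free, of some rank
    p, and by exactness the Euler characteristic is (-1)^l p
    ([diagonal_betti]).  Thus the coefficient of q^l has the sign (-1)^l, and
    it determines p, which determines MH_{l,l}(G) up to isomorphism; all other
    homology groups of length l vanish.

    The rank count is carried out over the integers.  A kernel is handled
    through a basis together with a retraction onto it ([split_kernel], obtained
    from the Smith normal form); exactness at one spot then splits the next
    chain group as a sum of two kernels ([exact_rank]), and the ranks agree
    because a commutative ring has the invariant basis property. *)

(** * Kernels of integer matrices and exact sequences *)

(** The rows of [B] are a basis of the left kernel of [A], and multiplication
    by [C] computes coordinates in this basis.  In particular the kernel is a
    direct summand, which is what makes rank counting possible without passing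
    to the rational numbers. *)
Definition split_kernel m n p (A : 'M[int]_(m, n)) (B : 'M_(p, m))
    (C : 'M_(m, p)) :=
  [/\ B *m A = 0, B *m C = 1%:M &
      forall u : 'rV_m, u *m A = 0 -> u *m C *m B = u].

(** In the Smith normal form A = L D R, the vector u is in the kernel of A if
    and only if u L is supported on the zero rows of D.  So the corresponding
    rows of L^-1 form a basis of the kernel, and the corresponding columns of L
    read off the coordinates. *)
Lemma int_split_kernel m n (A : 'M[int]_(m, n)) :
  exists p, exists B, exists C, @split_kernel m n p A B C.
Proof.
have [L L_unit [R R_unit [d _ ->]]] := int_Smith_normal_form A.
set D := \matrix_(i, j) _.
pose T := [set i | row i D == 0].
exists #|T|, (rowsub enum_val (invmx L)), (colsub enum_val L); split.
- rewrite mul_rowsub_mx !mulmxA mulVmx // mul1mx -mul_rowsub_mx.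
  suff -> : rowsub enum_val D = 0 :> 'M_(#|T|, n) by rewrite mul0mx.
  apply/row_matrixP => i; rewrite row_rowsub row0.
  by have := enum_valP i; rewrite inE => /eqP.
- rewrite mul_rowsub_mx mulmx_colsub mulVmx //.
  by apply/matrixP => i j; rewrite !mxE (inj_eq enum_val_inj).
move=> u; rewrite !mulmxA => /(congr1 (mulmx^~ (invmx R))).
rewrite mulmxK // mul0mx => uLD0; rewrite mulmx_colsub.
rewrite -[RHS](mulmxK L_unit); move: (u *m L) uLD0 => {u}w wD0.
have w0 i : i \notin T -> w 0 i = 0.
  rewrite inE => /rV0Pn[j]; rewrite [row i D 0 j]mxE [D i j]mxE.
  case: (i =P j :> nat) => [ij | _]; last by rewrite mulr0n eqxx.
  rewrite mulr1n => d0; have := congr1 (fun M : 'rV_n => M 0 j) wD0.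
  rewrite !mxE (bigD1 i) //= [D i j]mxE ij eqxx mulr1n big1 => [|k ne_ki].
    by rewrite addr0 -ij => /eqP; rewrite mulf_eq0 (negPf d0) orbF => /eqP.
  by rewrite mxE -ij val_eqE (negPf ne_ki) mulr0.
apply/rowP => j; rewrite !mxE [RHS](bigID [in T]) /= [X in _ + X]big1.
  by rewrite addr0 [RHS]big_enum_val /=; apply: eq_bigr => i _; rewrite !mxE.
by move=> i /w0 ->; rewrite mul0r.
Qed.

(** By exactness A' maps Z^m onto the kernel of A, which is free of rank p, so
    Z^m is the direct sum of a copy of it and of the kernel of A', which has
    rank q.  A lift [W] through A' of the basis [B], together with the basis
    [B'], gives an invertible (p + q) x m matrix, whence the equality of
    sizes. *)
Lemma exact_rank (m n r p q : nat) (A' : 'M[int]_(m, n)) (A : 'M[int]_(n, r))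
    (B : 'M_(p, n)) (C : 'M_(n, p)) (B' : 'M_(q, m)) (C' : 'M_(m, q)) :
  split_kernel A B C -> split_kernel A' B' C' -> A' *m A = 0 ->
  (forall u : 'rV_n, u *m A = 0 -> exists v, u = v *m A') ->
  m = (p + q)%N.
Proof.
move=> [BA0 BC1 kerA] [BA0' BC1' kerA'] A'A0 exA.
have kerA_mx k (U : 'M_(k, n)) : U *m A = 0 -> U *m C *m B = U.
  move=> UA0; apply/row_matrixP => i; rewrite !row_mul kerA //.
  by rewrite -row_mul UA0 row0.
have kerA'_mx k (U : 'M_(k, m)) : U *m A' = 0 -> U *m C' *m B' = U.
  move=> UA0; apply/row_matrixP => i; rewrite !row_mul kerA' //.
  by rewrite -row_mul UA0 row0.
have [W defB] : exists W : 'M_(p, m), W *m A' = B.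
  have ex_v i : exists v, row i B = v *m A'.
    by apply: exA; rewrite -row_mul BA0 row0.
  have [v def_v] := fin_all_exists ex_v.
  exists (\matrix_i v i); apply/row_matrixP => i.
  by rewrite row_mul rowK -def_v.
(* [X] computes the coordinates along [W], and [Y] those along [B'] of the
   remaining part, which [A'] kills. *)
pose X := A' *m C; pose Y := (1%:M - X *m W) *m C'.
have WX : W *m X = 1%:M by rewrite mulmxA defB.
have BX : B' *m X = 0 by rewrite mulmxA BA0' mul0mx.
have WY : W *m Y = 0.
  by rewrite mulmxA mulmxBr mulmx1 mulmxA WX mul1mx subrr mul0mx.
have BY : B' *m Y = 1%:M.
  by rewrite mulmxA mulmxBr mulmx1 mulmxA BX mul0mx subr0.
apply/eqP; rewrite eqn_leq; apply/andP; split.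
  apply: (@mulmx1_min _ _ _ (row_mx X Y) (col_mx W B')).
  rewrite mul_row_col kerA'_mx ?subrKC //.
  by rewrite mulmxBl mul1mx -!mulmxA defB mulmxA kerA_mx // subrr.
apply: (@mulmx1_min _ _ _ (col_mx W B') (row_mx X Y)).
by rewrite mul_col_row WX WY BX BY -scalar_mx_block.
Qed.

(** For 0 < k <= l, [n k] is the sum of the ranks of the kernels of [D k] and
    [D k.-1] ([exact_rank]), so the alternating sum telescopes.  The matrix
    [D 0] goes from [n 0] to [n 0], because [0.-1] is [0]; taking it to be zero
    makes every chain of degree 0 a cycle. *)
Lemma exact_euler (n : nat -> nat) (D : forall k, 'M[int]_(n k, n k.-1)) l :
  D 0%N = 0 -> (forall k, D k.+1 *m D k = 0) ->
  (forall k, (k < l)%N ->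
     forall u : 'rV_(n k), u *m D k = 0 -> exists v, u = v *m D k.+1) ->
  forall p (B : 'M_(p, n l)) (C : 'M_(n l, p)), split_kernel (D l) B C ->
  \sum_(k < l.+1) (-1) ^+ k * (n k)%:Z = (-1) ^+ l * p%:Z.
Proof.
move=> D0 DD; elim: l => [|l IHl] exD p B C kerDl.
  rewrite big_ord1 !mul1r; case: kerDl => _ BC1 kerD.
  congr Posz; apply/eqP; rewrite eqn_leq (mulmx1_min BC1) andbT.
  apply: (@mulmx1_min _ _ _ C B); apply/row_matrixP => i.
  by rewrite -[C]mul1mx -mulmxA row_mul mulmxA kerD // D0 mulmx0.
have [p' [B' [C' kerD]]] := int_split_kernel (D l).
rewrite big_ord_recr /= (IHl _ p' B' C') // => [|k lt_kl]; last first.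
  by apply: exD; apply: ltnW.
rewrite (exact_rank kerD kerDl) //; last exact: exD.
by rewrite exprS mulN1r !mulNr PoszD mulrDr opprD addNKr.
Qed.

(** * Distances and lengths *)

Lemma gdist0 (G : graph) (x : G) : gdist x x = Some 0.
Proof.
by apply/gdist_SomeP; split=> //; apply/existsP; exists [tuple] => /=.
Qed.

Lemma gdist_eq0 (G : graph) (x y : G) : gdist x y = Some 0 -> x = y.
Proof. by case/gdist_SomeP=> /existsP[p]; rewrite tuple0 => /= /eqP. Qed.

Lemma gdist_triangle (G : graph) (x y z : G) m n :
  gdist x y = Some m -> gdist y z = Some n ->
  exists2 k, gdist x z = Some k & (k <= m + n)%N.
Proof.
case/gdist_SomeP=> /existsP[p /andP[xp /eqP px]] _.
case/gdist_SomeP=> /existsP[q /andP[yq /eqP qy]] _.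
have w_xz : walk (m + n) x z.
  apply/existsP; exists [tuple of p ++ q] => /=.
  by rewrite cat_path last_cat px qy xp yq eqxx.
case E: (gdist x z) => [k|]; last first.
  by have := proj1 (gdist_NoneP _ _) E (m + n)%N; rewrite w_xz.
by exists k => //; have [_ ->] := proj1 (gdist_SomeP _ _ _) E.
Qed.

Lemma tlength_cons2 (G : graph) (x y : G) p :
  tlength [:: x, y & p] = oaddn (gdist x y) (tlength (y :: p)).
Proof. by []. Qed.

Lemma oaddn_Some a b n : oaddn a b = Some n ->
  exists i j, [/\ a = Some i, b = Some j & n = (i + j)%N].
Proof. by case: a b => [i|] [j|] //= [<-]; exists i, j. Qed.

(** Omission of an entry, as an operation on sequences, where induction on the
    position is available. *)
Definition del T i (s : seq T) := take i s ++ drop i.+1 s.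

Lemma val_omit (G : graph) k (i : 'I_k.+2) (t : k.+2.-tuple G) :
  omit i t = del i t :> seq G.
Proof.
have x0 := thead t; have lt_i := ltn_ord i.
have sz : size (del i t) = k.+1.
  by rewrite size_cat size_take size_drop size_tuple lt_i; lia.
apply: (@eq_from_nth _ x0) => [|j]; first by rewrite size_tuple sz.
rewrite size_tuple => lt_j.
rewrite -[j]/(val (Ordinal lt_j)) -tnth_nth tnth_mktuple.
rewrite (tnth_nth x0) /= /bump nth_cat size_take size_tuple lt_i.
case: ltnP => le_ij.
  by rewrite nth_take // add0n.
by rewrite nth_drop add1n addSn subnKC.
Qed.

(** By the triangle inequality, omitting an entry after the first does not
    increase the length.  If the length is unchanged, the omitted y between x
    and z satisfies d(x,z) = d(x,y) + d(y,z) > 0, so no two equal entries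
    become consecutive. *)
Lemma tlength_del (G : graph) (x : G) p i b : tlength (x :: p) = Some b ->
  exists a, [/\ tlength (x :: del i p) = Some a, (a <= b)%N &
    a = b -> path (fun y z => y != z) x p ->
    path (fun y z => y != z) x (del i p)].
Proof.
elim: p i x b => [|y p IHp] i x b; first by exists b.
rewrite tlength_cons2 => /oaddn_Some[m [n [dxy lp ->]]].
case: i => [|i].
  rewrite [del _ _]drop0; case: p lp {IHp} => [|z p] lp; first by exists 0%N.
  move: lp; rewrite !tlength_cons2 => /oaddn_Some[m' [n' [dyz lp ->]]].
  have [k dxz le_k] := gdist_triangle dxy dyz.
  exists (k + n')%N; rewrite dxz lp; split=> //; first lia.
  move=> eq_k /= /and3P[ne_xy _ ->]; rewrite andbT.
  apply: contraNneq ne_xy => eq_xz.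
  move: dxz; rewrite eq_xz gdist0 => -[k0].
  by rewrite -eq_xz; apply/eqP/gdist_eq0; rewrite dxy; congr Some; lia.
have [a [la le_a path_a]] := IHp i y n lp.
exists (m + a)%N; rewrite -[del i.+1 _]/(y :: del i p) tlength_cons2 dxy la.
split=> //; first lia.
by move=> eq_a /= /andP[-> /path_a->] //; lia.
Qed.

(** If a double omission keeps the length, then so does the first omission,
    because lengths only decrease.  Hence in the square of the differential the
    faces that were set to 0 cannot contribute, and the simplicial computation
    applies. *)
Lemma omit_mc_tuple (G : graph) k l (i : 'I_k.+3) (j : 'I_k.+2)
    (t : k.+3.-tuple G) :
  (0 < i)%N -> (0 < j)%N -> mc_tuple l t ->
  mc_tuple l (omit j (omit i t)) -> mc_tuple l (omit i t).
Proof.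
rewrite /mc_tuple !val_omit; case/tupleP: t => x p.
case: i j => [[|i] lti] [[|j] ltj] // _ _.
(* Since the omitted positions are not 0, the first vertex stays in place. *)
pose neq_path q := path (fun y z : G => y != z) x q.
change (neq_path p && (tlength (x :: p) == Some l) ->
  neq_path (del j (del i p)) && (tlength (x :: del j (del i p)) == Some l) ->
  neq_path (del i p) && (tlength (x :: del i p) == Some l)).
case/andP=> path_p /eqP len_p.
have [a [len_a le_a path_a]] := tlength_del i len_p.
have [b [len_b le_b _]] := tlength_del j len_a.
rewrite len_b => /andP[_ /eqP[eq_bl]].
have eq_al : a = l by lia.
by rewrite /neq_path path_a // len_a eq_al eqxx.
Qed.

(** * The differential squares to zero *)

Lemma omit_omit (G : graph) k (t : k.+3.-tuple G) i j :
  (j < i)%N -> (i < k.+3)%N ->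
  omit (inord j) (omit (inord i) t) = omit (inord i.-1) (omit (inord j) t).
Proof.
move=> lt_ji lt_i; apply: eq_from_tnth => m; rewrite !tnth_mktuple.
congr (tnth t _); apply: val_inj; rewrite /= !inordK; try lia.
rewrite /bump; lia.
Qed.

Lemma big_inner_ord (V : zmodType) n (f : nat -> V) :
  \sum_(i < n.+1 | (0 < i < n)%N) f i = \sum_(1 <= i < n) f i.
Proof.
rewrite big_mkcond big_ord_recr /= ltnn andbF addr0 -big_mkcond big_geq_mkord.
by apply: eq_bigl => i; rewrite ltn_ord andbT.
Qed.

(** The simplicial cancellation.  In passing from [n] to [n.+1], the new terms
    are those with i = n + 1 and those with j = n, and the symmetry of F pairs
    them off with opposite signs. *)
Lemma alternating_double_sum (V : zmodType) (F : nat -> nat -> V) n :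
  (forall i j, (0 < j < i)%N -> (i <= n)%N -> F i j = F j i.-1) ->
  \sum_(1 <= i < n.+1) \sum_(1 <= j < n) F i j *~ (-1) ^+ j *~ (-1) ^+ i = 0.
Proof.
elim: n => [|[|n] IHn] symF; first by rewrite big_geq.
  by rewrite big1 // => i _; rewrite big_geq.
rewrite big_nat_recr //=.
under eq_bigr do rewrite big_nat_recr //=.
rewrite big_split /= IHn ?add0r => [|i j lt_ji le_i]; last first.
  by rewrite symF // ltnW.
rewrite -big_split /= big_nat big1 // => i /andP[i_gt0 lt_i].
rewrite [F n.+2 i]symF ?i_gt0 //= [X in _ + X]mulrzAC.
by rewrite [(-1) ^+ n.+2]exprS mulN1r mulrNz mulNrz subrr.
Qed.

Section Complex.
Variables (G : graph) (l : nat).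

Lemma mc_diff_basis k (t : mc_gen G k.+1 l) :
  mc_diff (mc_basis t) =
  \sum_(i : 'I_k.+2 | (0 < i < k.+1)%N) mc_face l i (val t) *~ (-1) ^+ i.
Proof.
rewrite /mc_diff /mc_basis (bigD1 t) //= [X in _ + X]big1 ?addr0 => [|s ne_st].
  by rewrite ffunE eqxx mulr1z.
by rewrite ffunE (negPf ne_st) mulr0z.
Qed.

(** This holds also when omitting [i] shortens the tuple, in which case the
    left-hand side is 0: then no further face of it has length [l]. *)
Lemma mc_diff_face k (t : mc_gen G k.+2 l) (i : 'I_k.+3) : (0 < i)%N ->
  mc_diff (mc_face l i (val t)) =
  \sum_(j : 'I_k.+2 | (0 < j < k.+1)%N)
    mc_face l j (omit i (val t)) *~ (-1) ^+ j.
Proof.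
move=> i_gt0; rewrite /(mc_face l i); case: insubP => [s _ def_s | not_mc].
  by rewrite mc_diff_basis def_s.
rewrite raddf0 big1 // => j /andP[j_gt0 _].
rewrite /mc_face insubF ?mul0rz //; apply: contraNF not_mc.
exact: omit_mc_tuple (valP t).
Qed.

Lemma mc_diffE k (c : MC G k.+1 l) :
  mc_diff c = \sum_t mc_diff (mc_basis t) *~ c t.
Proof. by apply: eq_bigr => t _; rewrite mc_diff_basis. Qed.

Lemma mc_diffK k (c : MC G k.+2 l) : mc_diff (mc_diff c) = 0.
Proof.
rewrite (mc_diffE c) raddf_sum big1 //= => t _.
rewrite raddfMz mc_diff_basis raddf_sum -[RHS](mul0rz _ (c t)).
congr (_ *~ _).
under eq_bigr => i /andP[i_gt0 _] do
  rewrite raddfMz /= mc_diff_face // mulrz_suml.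
pose F i j := mc_face l (inord j : 'I_k.+2) (omit (inord i) (val t)).
pose S i := \sum_(1 <= j < k.+1) F i j *~ (-1) ^+ j *~ (-1) ^+ i.
transitivity (\sum_(i < k.+3 | (0 < i < k.+2)%N) S i).
  apply: eq_bigr => i _; rewrite /S -big_inner_ord; apply: eq_bigr => j _.
  by rewrite /F !inord_val.
rewrite big_inner_ord alternating_double_sum // => i j /andP[_ lt_ji] le_i.
by rewrite /F /mc_face omit_omit //; apply: leq_trans le_i _.
Qed.

(** * The differential as an integer matrix *)

Definition mc_vec k (c : MC G k l) : 'rV[int]_#|{: mc_gen G k l}| :=
  \row_j c (enum_val j).

Definition mc_of_vec k (u : 'rV[int]_#|{: mc_gen G k l}|) : MC G k l :=
  [ffun t => u 0 (enum_rank t)].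

Lemma mc_vecK k : cancel (@mc_vec k) (@mc_of_vec k).
Proof. by move=> c; apply/ffunP => t; rewrite ffunE mxE enum_rankK. Qed.

Lemma mc_of_vecK k : cancel (@mc_of_vec k) (@mc_vec k).
Proof. by move=> u; apply/rowP => j; rewrite mxE ffunE enum_valK. Qed.

(** In degree 0 the target [k.-1] is again 0, and the matrix is zero, in
    accordance with all 0-chains being cycles. *)
Definition mc_diff_mx k :
    'M[int]_(#|{: mc_gen G k l}|, #|{: mc_gen G k.-1 l}|) :=
  match k with
  | 0 => 0
  | k'.+1 => \matrix_i mc_vec (mc_diff (mc_basis (enum_val i)))
  end.

Lemma mc_vec_diff k (c : MC G k.+1 l) :
  mc_vec (mc_diff c) = mc_vec c *m mc_diff_mx k.+1.
Proof.
apply/rowP => j; rewrite !mxE mc_diffE sum_ffunE /=.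
rewrite [LHS](reindex _ (onW_bij _ (@enum_val_bij _))).
apply: eq_bigr => i _.
by rewrite ffunMzE !mxE mulrC -mulrzr intz.
Qed.

Lemma mc_diff_mxM k : mc_diff_mx k.+1 *m mc_diff_mx k = 0.
Proof.
case: k => [|k]; first by rewrite mulmx0.
apply/row_matrixP => i; rewrite -[mc_diff_mx k.+2]mul1mx -mulmxA row_mul mulmxA.
rewrite -(mc_of_vecK (row i _)) -!mc_vec_diff mc_diffK row0.
by apply/rowP => j; rewrite !mxE ffunE.
Qed.

Lemma mc_cycle_vec k (c : MC G k l) :
  (c \in @mc_cycle G k l) = (mc_vec c *m mc_diff_mx k == 0).
Proof.
case: k c => [|k] c; first by rewrite mulmx0 eqxx.
rewrite unfold_in -mc_vec_diff -(inj_eq (can_inj (@mc_vecK k))).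
by congr (_ == _); apply/rowP => j; rewrite !mxE ffunE.
Qed.

End Complex.

(** * Homology of a diagonal graph *)

Local Open Scope quotient_scope.

Lemma MZ_pi_eq0 (G : graph) k l (z : MZ G k l) :
  (\pi_(MH G k l) z = 0) <-> exists c, mc_diff c = val z.
Proof.
transitivity (z \in @mc_boundary G k l); last first.
  by split=> [/asboolP|ex_c]; [|apply/asboolP].
rewrite -[z in X in _ <-> X]subr0 Quotient.idealrBE.
have -> : \pi_(MH G k l) 0 = 0 by rewrite piE.
by split=> [/eqP|/eqP].
Qed.

Lemma MH_eq0_exact (G : graph) k l : (forall h : MH G k l, h = 0) ->
  forall u : 'rV_#|{: mc_gen G k l}|, u *m mc_diff_mx G l k = 0 ->
  exists v, u = v *m mc_diff_mx G l k.+1.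
Proof.
move=> MH0 u uD0.
have cyc_u : mc_of_vec u \in @mc_cycle G k l.
  by rewrite mc_cycle_vec mc_of_vecK uD0.
have [c dc] := proj1 (MZ_pi_eq0 (Sub (mc_of_vec u) cyc_u : MZ G k l)) (MH0 _).
by exists (mc_vec c); rewrite -mc_vec_diff dc SubK mc_of_vecK.
Qed.

Lemma tlength_ge_size (G : graph) (x : G) p n :
  path (fun y z => y != z) x p -> tlength (x :: p) = Some n -> (size p <= n)%N.
Proof.
elim: p x n => // y p IHp x n /= /andP[ne_xy yp].
rewrite -/(tlength (y :: p)) => /oaddn_Some[i [j [dxy /(IHp _ _ yp) le_j ->]]].
case: i dxy => [/gdist_eq0/eqP|i _]; first by rewrite (negPf ne_xy).
by rewrite addSn ltnS (leq_trans le_j) ?leq_addl.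
Qed.

Lemma mc_gen_le (G : graph) k l : mc_gen G k l -> (k <= l)%N.
Proof.
case=> t; case/tupleP: t => x p /andP[path_p /eqP].
by move/(tlength_ge_size path_p); rewrite size_tuple.
Qed.

Lemma additive_inverse (U V : zmodType) (f : {additive U -> V}) :
  bijective f -> exists g : {additive V -> U}, bijective g.
Proof.
case=> g fK gK.
have gB : zmod_morphism g.
  by move=> x y; apply: (can_inj fK); rewrite raddfB !gK.
pose g_add : {additive V -> U} :=
  HB.pack g (GRing.isZmodMorphism.Build V U g gB).
by exists g_add; exists f.
Qed.

(** In the top degree every homology class contains exactly one cycle, as there
    are no nonzero chains of degree l + 1 and length l; and the cycles are the
    kernel of the differential, with basis [B]. *)
Lemma MH_top_free (G : graph) l p (B : 'M_(p, #|{: mc_gen G l l}|)) C :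
  split_kernel (mc_diff_mx G l l) B C ->
  exists f : {additive 'rV[int]_p -> MH G l l}, bijective f.
Proof.
case=> BD0 BC1 kerD.
have cycB (u : 'rV_p) : mc_of_vec (u *m B) \in @mc_cycle G l l.
  by rewrite mc_cycle_vec mc_of_vecK -mulmxA BD0 mulmx0.
pose z u : MZ G l l := Sub (mc_of_vec (u *m B)) (cycB u).
have zB : zmod_morphism z.
  move=> u v; apply: val_inj; rewrite raddfB !SubK.
  by apply/ffunP => t; rewrite mulmxBl !ffunE !mxE.
have fB : zmod_morphism (fun u => \pi_(MH G l l) (z u)).
  by move=> u v; rewrite zB !piE.
pose f : {additive 'rV[int]_p -> MH G l l} :=
  HB.pack (fun u => \pi_(MH G l l) (z u))
   (GRing.isZmodMorphism.Build _ _ (fun u => \pi_(MH G l l) (z u)) fB).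
(* There are no generators of degree [l.+1] by [mc_gen_le]. *)
have pi_inj : injective \pi_(MH G l l).
  move=> z1 z2 /eqP; rewrite -Quotient.idealrBE => /asboolP[c dc].
  apply/eqP; rewrite -subr_eq0; apply/eqP/val_inj; rewrite -dc raddf0.
  by rewrite /mc_diff big1 // => t; have := mc_gen_le t; rewrite ltnn.
exists f.
exists (fun h : MH G l l => mc_vec (val (repr h : MZ G l l)) *m C) => [u | h].
  rewrite /f /= (pi_inj _ _ (reprK _)).
  by rewrite SubK mc_of_vecK -mulmxA BC1 mulmx1.
rewrite /f /= -[RHS]reprK; congr (\pi_(MH G l l) _); apply: val_inj.
rewrite SubK kerD ?mc_vecK //; apply/eqP; rewrite -mc_cycle_vec.
exact: (valP (repr h)).
Qed.

(** One rank [p] governs both the Euler characteristic of MC_{*,l}(G) and the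
    only nonzero homology group of length l. *)
Lemma diagonal_betti (G : graph) l : diagonal G ->
  exists p,
    \sum_(k < l.+1) (-1) ^+ k * #|{: mc_gen G k l}|%:Z = (-1) ^+ l * p%:Z /\
    exists f : {additive 'rV[int]_p -> MH G l l}, bijective f.
Proof.
move=> diagG; have [p [B [C kerD]]] := int_split_kernel (mc_diff_mx G l l).
exists p; split; last exact: MH_top_free kerD.
apply: (exact_euler (n := fun k => #|{: mc_gen G k l}|) _ _ _ kerD) => //.
  exact: mc_diff_mxM.
move=> k lt_kl; apply: MH_eq0_exact; apply: diagG.
by move=> eq_kl; rewrite eq_kl ltnn in lt_kl.
Qed.

Local Close Scope quotient_scope.

(** * Coefficients of the magnitude *)

Lemma coefz_sum I (r : seq I) (P : pred I) (F : I -> zseries) n :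
  coefz (\sum_(i <- r | P i) F i) n = \sum_(i <- r | P i) coefz (F i) n.
Proof. exact: (big_morph (fun a => coefz a n)). Qed.

Lemma coefz_sign k a n : coefz ((-1) ^+ k * a) n = (-1) ^+ k * coefz a n.
Proof.
elim: k => [|k IHk]; first by rewrite !mul1r.
by rewrite !exprS -!mulrA !mulN1r -IHk.
Qed.

Lemma coefz_qpow_dist d n : coefz (qpow_dist d) n = (d == Some n)%:R.
Proof. by case: d => [m|] //=; rewrite eq_sym. Qed.

Lemma qpowD a b : qpow (a + b) = qpow a * qpow b.
Proof.
apply: zseriesP => n /=; case: (leqP a n) => [le_an | lt_na].
  rewrite (bigD1 (Ordinal (le_an : (a < n.+1)%N))) //= eqxx mul1r.
  rewrite big1 ?addr0 => [|i]; last first.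
    by rewrite -val_eqE /= => /negPf ->; rewrite mul0r.
  by congr (nat_of_bool _)%:R; lia.
rewrite big1 => [|i _]; last first.
  have -> : (i == a :> nat) = false by have := ltn_ord i; lia.
  by rewrite mul0r.
have -> // : (n == a + b)%N = false by lia.
Qed.

Lemma qpow_distD d e : qpow_dist (oaddn d e) = qpow_dist d * qpow_dist e.
Proof.
by case: d e => [m|] [n|] /=; rewrite ?mulr0 ?mul0r //; apply: qpowD.
Qed.

Lemma big_tuple_cons (V : nmodType) (T : finType) k (P : pred (k.+1.-tuple T))
    (F : k.+1.-tuple T -> V) :
  \sum_(t | P t) F t =
  \sum_x \sum_(p : k.-tuple T | P [tuple of x :: p]) F [tuple of x :: p].
Proof.
rewrite pair_big_dep /=.
rewrite (reindex (fun xp : T * k.-tuple T => [tuple of xp.1 :: xp.2])) //=.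
exists (fun t => (thead t, [tuple of behead t])) => [[x p]|t] _ /=.
  by congr pair; apply: val_inj.
by rewrite -tuple_eta.
Qed.

Section Magnitude.
Variable G : graph.

(** The generating function by length of the generators of degree [k] starting
    at [x].  It is the entry at [x] of N^k 1, where N is zeta minus the identity
    and 1 is the all-ones vector. *)
Definition walk_series k (x : G) : zseries :=
  \sum_(p : k.-tuple G | path (fun y z => y != z) x p)
    qpow_dist (tlength (x :: p)).

Lemma walk_series0 x : walk_series 0 x = 1.
Proof.
rewrite /walk_series (big_pred1 [tuple]) // => p.
by rewrite tuple0; apply/esym/eqP.
Qed.

(** This is (1 + N) N^k 1 = N^k 1 + N^(k+1) 1: in the sum over the vertices y,
    the term y = x prolongs no sequence, and every other y puts x in front of
    one starting at y. *)
Lemma walk_seriesS k x :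
  \sum_y qpow_dist (gdist x y) * walk_series k y =
  walk_series k x + walk_series k.+1 x.
Proof.
rewrite (bigD1 x) //= gdist0 mul1r; congr (_ + _).
rewrite [RHS]big_tuple_cons big_mkcond; apply: eq_bigr => y _ /=.
rewrite eq_sym; case: (x != y) => /=; last by rewrite big_pred0.
rewrite mulr_sumr; apply: eq_bigr => p _.
by rewrite -qpow_distD -tlength_cons2.
Qed.

Lemma walk_series_small k x n : (n < k)%N -> coefz (walk_series k x) n = 0.
Proof.
move=> lt_nk; rewrite coefz_sum big1 // => p path_p; rewrite coefz_qpow_dist.
case: eqP => // /(tlength_ge_size path_p).
by rewrite size_tuple leqNgt lt_nk.
Qed.

Lemma sum_walk_series k l :
  \sum_x coefz (walk_series k x) l = #|{: mc_gen G k l}|%:Z.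
Proof.
rewrite card_sig -sum1_card -natz natr_sum.
rewrite big_tuple_cons; apply: eq_bigr => x _.
rewrite coefz_sum [RHS]big_mkcond [LHS]big_mkcond; apply: eq_bigr => p _.
rewrite coefz_qpow_dist unfold_in /mc_tuple /=.
by case: path => //=; case: eqP.
Qed.

(** The geometric series may be truncated after k = l, since N^(l+1) is
    divisible by q^(l+1). *)
Lemma magnitude_coef l : coefz (magnitude G) l =
  \sum_(k < l.+1) (-1) ^+ k * #|{: mc_gen G k l}|%:Z.
Proof.
pose v k : 'cV[zseries]_#|G| := \col_i walk_series k (enum_val i).
have zv k : zeta G *m v k = v k + v k.+1.
  apply/colP => i; rewrite !mxE -walk_seriesS.
  rewrite [RHS](reindex _ (onW_bij _ (@enum_val_bij _))).
  by apply: eq_bigr => j _; rewrite !mxE.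
have zsum n :
    zeta G *m (\sum_(k < n) (-1) ^+ k *: v k) = v 0%N - (-1) ^+ n *: v n.
  elim: n => [|n IHn]; first by rewrite big_ord0 mulmx0 scale1r subrr.
  rewrite big_ord_recr mulmxDr IHn -scalemxAr zv scalerDr addrA subrK.
  by rewrite exprS mulN1r scaleNr opprK.
have mag : magnitude G = \sum_i (invmx (zeta G) *m v 0%N) i 0.
  apply: eq_bigr => i _; rewrite mxE; apply: eq_bigr => j _.
  by rewrite mxE walk_series0 mulr1.
have -> : coefz (magnitude G) l =
    \sum_i coefz ((\sum_(k < l.+1) (-1) ^+ k *: v k) i 0) l.
  rewrite mag coefz_sum; apply: eq_bigr => i _.
  have -> : v 0%N = zeta G *m (\sum_(k < l.+1) (-1) ^+ k *: v k)
      + (-1) ^+ l.+1 *: v l.+1 by rewrite zsum subrK.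
  rewrite mulmxDr mulKmx ?zeta_unit // -scalemxAr mxE.
  rewrite [RHS]/= -[RHS]addr0; congr (_ + _).
  rewrite mxE coefz_sign mxE coefz_sum big1 ?mulr0 // => j _ /=.
  rewrite mxE big1 // => k _.
  by rewrite walk_series_small ?mulr0 // ltnS leq_subr.
under eq_bigr do rewrite summxE coefz_sum.
rewrite exchange_big; apply: eq_bigr => k _.
rewrite -sum_walk_series mulr_sumr.
rewrite [RHS](reindex _ (onW_bij _ (@enum_val_bij _))).
by apply: eq_bigr => i _; rewrite !mxE coefz_sign.
Qed.
End Magnitude.

Theorem proposition34 (G : graph) (diagG : diagonal G) :
  (forall l : nat, exists n : nat, coefz (magnitude G) l = (-1) ^+ l * n%:Z) /\
  (forall G' : graph, diagonal G' -> magnitude G = magnitude G' ->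
     bigraded_iso (MH G) (MH G')).
Proof.
split=> [l | G' diagG' eq_mag k l].
  have [p [eq_p _]] := diagonal_betti l diagG.
  by exists p; rewrite magnitude_coef.
have [-> {k} | /eqP ne_kl] := eqVneq k l; last first.
  exists (\0 : {additive MH G k l -> MH G' k l}); exists (fun=> 0) => h.
    by rewrite (diagG _ _ ne_kl h).
  by rewrite (diagG' _ _ ne_kl h).
have [p [eq_p [f /additive_inverse[g bij_g]]]] := diagonal_betti l diagG.
have [p' [eq_p' [f' bij_f']]] := diagonal_betti l diagG'.
have eq_pp' : p = p'.
  have /(canLR (signrMK _))  : (-1) ^+ l * p%:Z = (-1) ^+ l * p'%:Z.
    by rewrite -eq_p -eq_p' -!magnitude_coef eq_mag.
  by rewrite signrMK => -[].
case: p' / eq_pp' eq_p' f' bij_f' => _ f' bij_f'.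
by exists (f' \o g : {additive MH G l l -> MH G' l l}); apply: bij_comp.
Qed.
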